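(* Let $(R,m_R)$ be a Noetherian local ring of dimension $d\geq 1$ such that $\dim N(\hat{R})<d$, let $M$ be a finitely generated $R$-module, and let $\mathcal{I}(1)=\{I(1)_j\},\ldots,\mathcal{I}(r)=\{I(r)_j\}$ be filtrations of $R$ by $m_R$-primary ideals. Assume further that $e\left(\mathcal{I}(j);M\right)=0$ for some $j$ with $1\leq j\leq r$. Then $$e\left(\mathcal{I}(1)^{[d_1]},\ldots,\mathcal{I}(r)^{[d_r]};M\right)=0$$ for any $d_1,\ldots,d_r\in\mathbb{N}$ satisfying $d_1+\cdots+d_r=d$ and $d_j>0$.
   Context: $\mathbb{N}=\{0,1,2,\ldots\}$ and $r\geq 1$ is an integer. $\hat{R}$ is the $m_R$-adic completion of $R$, and $N(\hat{R})$ is its nilradical; $\dim N(\hat{R})$ denotes the dimension of $N(\hat{R})$ as an $\hat{R}$-module, i.e. the Krull dimension of $\hat{R}/\mathrm{ann}_{\hat{R}}(N(\hat{R}))$ (the condition $\dim N(\hat{R})<d$ holds when $N(\hat{R})=0$). $l_R$ denotes length of an $R$-module. A filtration $\mathcal{I}=\{I_n\}_{n\in\mathbb{N}}$ of $R$ is a descending chain of ideals $R=I_0\supseteq I_1\supseteq I_2\supseteq\cdots$ such that $I_iI_j\subseteq I_{i+j}$ for all $i,j\in\mathbb{N}$. It is a filtration of $R$ by $m_R$-primary ideals if $I_n$ is $m_R$-primary for every $n\geq 1$. (The filtration is not assumed Noetherian, i.e. $\bigoplus_{n\ge 0} I_n$ need not be a finitely generated $R$-algebra.) Mixed multiplicities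 (Cutkosky, Sarkar, Srinivasan): let $(R,m_R)$ be a Noetherian local ring of dimension $d\ge 1$ with $\dim N(\hat{R})<d$, $M$ a finitely generated $R$-module, and $\mathcal{I}(1),\ldots,\mathcal{I}(r)$ filtrations of $R$ by $m_R$-primary ideals. It is a known theorem that for all integers $n_1,\ldots,n_r\geq 1$ the limit $$\lim_{t\to\infty}\frac{l_R\left(M/I(1)_{tn_1}\cdots I(r)_{tn_r}M\right)}{t^d}$$ exists, and that as a function of $(n_1,\ldots,n_r)$ it is given by a (unique) polynomial with real coefficients which is zero or homogeneous of total degree $d$. The mixed multiplicities $e(\mathcal{I}(1)^{[d_1]},\ldots,\mathcal{I}(r)^{[d_r]};M)\in\mathbb{R}$, for $d_1,\ldots,d_r\in\mathbb{N}$ with $d_1+\cdots+d_r=d$, are defined by writing this polynomial as $$\sum_{\substack{d_1+\cdots+d_r=d\\ d_i\in\mathbb{N}}}\frac{1}{d_1!\cdots d_r!}\,e\left(\mathcal{I}(1)^{[d_1]},\ldots,\mathcal{I}(r)^{[d_r]};M\right)n_1^{d_1}\cdots n_r^{d_r}.$$ The multiplicity of a single filtration $\mathcal{I}=\{I_n\}$ of $R$ by $m_R$-primary ideals is $$e(\mathcal{I};M)=d!\,\lim_{t\to\infty}\frac{l_R(M/I_tM)}{t^d}.$$ *)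

(* Defs.v *)
From HB Require Import structures.
From mathcomp Require Import all_boot all_order all_algebra.
From mathcomp Require Import boolp classical_sets functions reals ereal.
From mathcomp Require Import topology normedtype.
From mathcomp Require Import ring.

Set Implicit Arguments.
Unset Strict Implicit.
Unset Printing Implicit Defensive.

Import Order.TTheory GRing.Theory Num.Theory.
Import numFieldNormedType.Exports.

Local Open Scope classical_set_scope.
Local Open Scope ring_scope.

Section Modules.
Variables (R : comNzRingType) (V : lmodType R).
Implicit Types (I : set R) (N : set V).

Definition is_submodule N : Prop :=
  N 0 /\ forall (a : R) (u v : V), N u -> N v -> N (a *: u + v).

Definition generated (S : set V) : set V := smallest is_submodule S.

Definition finitely_generated N : Prop :=
  exists s : seq V, N = generated [set` s].

Definition ideal_smul I N : set V := generated [set a *: u | a in I & u in N].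

Definition annihilator N : set R := [set a | forall u, N u -> a *: u = 0].

(* The submodules of V / N are those of V containing N, so a chain as below
   is a strictly increasing chain of n + 1 submodules of V / N. *)
Definition submodule_chain N (n : nat) : Prop :=
  exists C : nat -> set V,
    [/\ forall i, is_submodule (C i), N `<=` C 0%N
      & forall i, (i < n)%N -> C i `<` C i.+1].

(* The length of V / N, possibly +oo. *)
Definition quotient_length (K : realType) N : \bar K :=
  ereal_sup [set n%:R%:E | n in submodule_chain N].

End Modules.

Section Ideals.
Variable R : comNzRingType.
Implicit Types (I J : set R).

Definition is_ideal I : Prop := is_submodule (I : set R^o).

Definition ideal_mul I J : set R := ideal_smul I (J : set R^o).

Definition ideal_exp I (n : nat) : set R := iter n (ideal_mul I) setT.

Definition noetherian : Prop :=
  forall I, is_ideal I -> finitely_generated (I : set R^o).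

Definition is_maximal_ideal I : Prop :=
  [/\ is_ideal I, I <> setT
    & forall J, is_ideal J -> I `<=` J -> J = I \/ J = setT].

(* R is local and m is its maximal ideal. *)
Definition local_ring (m : set R) : Prop :=
  is_maximal_ideal m /\ forall J, is_maximal_ideal J -> J = m.

Definition is_prime_ideal I : Prop :=
  [/\ is_ideal I, I <> setT & forall x y, I (x * y) -> I x \/ I y].

Definition radical I : set R := [set x | exists n : nat, I (x ^+ n)].

Definition nilradical : set R := radical [set 0].

Definition is_primary_ideal I : Prop :=
  [/\ is_ideal I, I <> setT & forall x y, I (x * y) -> I x \/ radical I y].

Definition is_primary_to (m I : set R) : Prop :=
  is_primary_ideal I /\ radical I = m.

(* The prime ideals of R / J are those of R containing J, so a chain as below
   is a strictly increasing chain of n + 1 prime ideals of R / J. *)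
Definition prime_chain J (n : nat) : Prop :=
  exists P : nat -> set R,
    [/\ forall i, (i <= n)%N -> is_prime_ideal (P i), J `<=` P 0%N
      & forall i, (i < n)%N -> P i `<` P i.+1].

Definition krull_dim_eq (d : nat) : Prop :=
  prime_chain [set 0] d /\ forall n, prime_chain [set 0] n -> (n <= d)%N.

(* The Krull dimension of R / ann N is less than d; this holds vacuously when
   N = 0, as no prime ideal contains ann N = R. *)
Definition module_dim_lt (V : lmodType R) (N : set V) (d : nat) : Prop :=
  forall n, prime_chain (annihilator N) n -> (n < d)%N.

Definition is_filtration (I : nat -> set R) : Prop :=
  [/\ forall n, is_ideal (I n), I 0%N = setT, forall n, I n.+1 `<=` I n
    & forall i j, ideal_mul (I i) (I j) `<=` I (i + j)%N].

Definition is_primary_filtration (m : set R) (I : nat -> set R) : Prop :=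
  is_filtration I /\ forall n, (1 <= n)%N -> is_primary_to m (I n).

End Ideals.

Arguments nilradical R : clear implicits.

Section SubmoduleFacts.
Variables (R : comNzRingType) (V : lmodType R).

Lemma generated_submodule (S : set V) : is_submodule (generated S).
Proof.
split=> [N [[N0 _] _] //|a u v Su Sv N NS].
have [[_ NZD] _] := NS.
by apply: NZD; [exact: Su|exact: Sv].
Qed.

Lemma submoduleD (N : set V) u v : is_submodule N -> N u -> N v -> N (u + v).
Proof. by move=> [_ NZD] Nu Nv; rewrite -[u]scale1r; exact: NZD. Qed.

Lemma submoduleZ (N : set V) a u : is_submodule N -> N u -> N (a *: u).
Proof. by move=> [N0 NZD] Nu; rewrite -[_ *: _]addr0; exact: NZD. Qed.

Lemma submoduleB (N : set V) u v : is_submodule N -> N u -> N v -> N (u - v).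
Proof.
move=> sN Nu Nv; rewrite -scaleN1r.
by apply: submoduleD => //; exact: submoduleZ.
Qed.

End SubmoduleFacts.

Section IdealFacts.
Variables (R : comNzRingType) (I : set R).

Lemma is_idealD x y : is_ideal I -> I x -> I y -> I (x + y).
Proof. exact: (@submoduleD R R^o). Qed.

Lemma is_idealB x y : is_ideal I -> I x -> I y -> I (x - y).
Proof. exact: (@submoduleB R R^o). Qed.

Lemma is_idealM a x : is_ideal I -> I x -> I (a * x).
Proof. exact: (@submoduleZ R R^o). Qed.

End IdealFacts.

Lemma ideal_exp_ideal (R : comNzRingType) (I : set R) n :
  is_ideal (ideal_exp I n).
Proof. by case: n => [//|n]; exact: generated_submodule. Qed.

(* The m-adic completion of R: the ring of m-adic Cauchy sequences modulo the
   ideal of sequences converging m-adically to 0. *)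
Section Completion.
Variables (R : comNzRingType) (m : idealr R).
Implicit Types u v : nat -> R.

Local Notation mpow n := (ideal_exp [set` m] n).

Definition adic_cauchy u : Prop :=
  forall n, exists N, forall i j, (N <= i)%N -> (N <= j)%N ->
    mpow n (u i - u j).

Definition adic_null u : Prop :=
  forall n, exists N, forall i, (N <= i)%N -> mpow n (u i).

Definition cauchy_pred : {pred nat -> R} := fun u => `[< adic_cauchy u >].

Fact cauchy_subring_closed : subring_closed cauchy_pred.
Proof.
split=> [|u v /asboolP cu /asboolP cv|u v /asboolP cu /asboolP cv];
  apply/asboolP => n.
- by exists 0%N => i j _ _; rewrite subrr; case: (ideal_exp_ideal [set` m] n).
- have [Nu Hu] := cu n; have [Nv Hv] := cv n.
  exists (maxn Nu Nv) => i j; rewrite !geq_max => /andP[ui vi] /andP[uj vj].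
  have -> : (u - v) i - (u - v) j = (u i - u j) - (v i - v j).
    by rewrite -[(u - v) i]/(u i - v i) -[(u - v) j]/(u j - v j); ring.
  by apply: (is_idealB (ideal_exp_ideal _ n)); [exact: Hu|exact: Hv].
- have [Nu Hu] := cu n; have [Nv Hv] := cv n.
  exists (maxn Nu Nv) => i j; rewrite !geq_max => /andP[ui vi] /andP[uj vj].
  have -> : (u * v) i - (u * v) j = u i * (v i - v j) + v j * (u i - u j).
    by rewrite -[(u * v) i]/(u i * v i) -[(u * v) j]/(u j * v j); ring.
  apply: (is_idealD (ideal_exp_ideal _ n));
    apply: (is_idealM _ (ideal_exp_ideal _ n)); by [exact: Hv|exact: Hu].
Qed.

HB.instance Definition _ :=
  GRing.isSubringClosed.Build (nat -> R) cauchy_pred cauchy_subring_closed.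

Record cauchy_seq := CauchySeq {
  cauchy_val :> nat -> R;
  _ : cauchy_val \in cauchy_pred }.

HB.instance Definition _ := [isSub for cauchy_val].
HB.instance Definition _ := [Choice of cauchy_seq by <:].
HB.instance Definition _ := [SubChoice_isSubComNzRing of cauchy_seq by <:].

Definition null_ideal : {pred cauchy_seq} :=
  fun u : cauchy_seq => `[< adic_null u >].

Fact null_idealr_closed : idealr_closed null_ideal.
Proof.
split=> [||a u v /asboolP nu /asboolP nv].
- by apply/asboolP => n; exists 0%N => i _; case: (ideal_exp_ideal [set` m] n).
- apply/negP => /asboolP /(_ 1%N)[N /(_ N (leqnn N))] m1.
  suff : mpow 1%N `<=` [set` m] by move=> /(_ _ m1) /=; rewrite idealr1.
  apply: smallest_sub.
    split=> [|b x y /= mx my]; first exact: rpred0.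
    by apply: rpredD => //; exact: idealMr.
  by move=> _ [b mb [c _ <-]] /=; rewrite /GRing.scale/= mulrC; exact: idealMr.
- apply/asboolP => n; have [Nu Hu] := nu n; have [Nv Hv] := nv n.
  exists (maxn Nu Nv) => i; rewrite geq_max => /andP[ui vi].
  exact: ((ideal_exp_ideal [set` m] n).2 (a i) _ _ (Hu _ ui) (Hv _ vi)).
Qed.

HB.instance Definition _ := isIdealr.Build _ null_ideal null_idealr_closed.

Definition completion : comNzRingType := {ideal_quot null_ideal}.

End Completion.

Arguments cauchy_pred {R} m _ : assert.
Arguments null_ideal {R} m _ : assert.

Section Multiplicities.
Variables (K : realType) (R : comNzRingType) (d : nat) (M : lmodType R).

(* l_R(M / I M) *)
Definition length_mod (I : set R) : \bar K :=
  quotient_length K (ideal_smul I [set: M]).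

(* The limit defining e(I; M) exists and e(I; M) = e. *)
Definition is_multiplicity (I : nat -> set R) (e : K) : Prop :=
  (fun t : nat => (d`!%:R)%:E * (length_mod (I t) * ((t%:R ^+ d)^-1)%:E))%E
    @ \oo --> e%:E.

Variable r : nat.

(* The exponents range over the maps c : 'I_r -> {0, ..., d} with sum d. *)
Definition mixed_polynomial (e : ('I_r -> nat) -> K) (n : 'I_r -> nat) : K :=
  \sum_(c : {ffun 'I_r -> 'I_d.+1} | (\sum_(i < r) c i == d)%N)
    (\prod_(i < r) (c i)`!%:R)^-1 * e (fun i => c i)
      * \prod_(i < r) (n i)%:R ^+ c i.

(* The limits defining the mixed multiplicities exist, are given by a
   homogeneous polynomial of degree d, and, for d_1 + ... + d_r = d, the number
   e (d_1, ..., d_r) is e(I(1)^[d_1], ..., I(r)^[d_r]; M). Only these values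
   of e matter, and they are determined. *)
Definition is_mixed_multiplicities (I : 'I_r -> nat -> set R)
    (e : ('I_r -> nat) -> K) : Prop :=
  forall n : 'I_r -> nat, (forall i, (1 <= n i)%N) ->
    (fun t : nat =>
       length_mod (\big[@ideal_mul R/setT]_(i < r) I i (t * n i)%N)
         * ((t%:R ^+ d)^-1)%:E)%E
      @ \oo --> (mixed_polynomial e n)%:E.

End Multiplicities.

(* Main.v *)
Require Import Defs.
From HB Require Import structures.
From mathcomp Require Import all_boot all_order all_algebra.
From mathcomp Require Import boolp classical_sets functions reals ereal.
From mathcomp Require Import topology normedtype.
From mathcomp Require Import ring.
From mathcomp Require polyrcf.

(** Let [P] be the homogeneous polynomial of degree [d] whose coefficients are,
    up to factorials, the mixed multiplicities. The claim is that [P] does not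
    involve the variable [n_j], and for this it suffices that [P] is bounded on
    each line in the direction of [n_j]: a bounded polynomial in one variable is
    constant ([bounded_poly_coef_eq0], [multivariate_bounded_coef_eq0]).

    The bound ([mixed_polynomial_bounded]) is a degenerate case of the Minkowski
    inequality [P(n + s e_j)^(1/d) <= P(n)^(1/d) + s P(e_j)^(1/d)], up to a
    constant. Fix [n] and put [Q = I(1)_(n_1) ... I(r)_(n_r)]. A system of
    parameters of [R] has suitable powers [y_1, ..., y_d] in [Q]. The product of
    the [I(i)_(t n_i)] then contains [y_1^t, ..., y_d^t], so at [n + s e_j] the
    length to be bounded is at most that of [M / (y_1^t L + ... + y_d^t L)],
    where [L = I(j)_(t s) M]. For all [x_1, ..., x_d] and [L],
    [l(M / (x_1 L + ... + x_d L)) <= l(M / (x_1, ..., x_d) M) + d l(M / L)]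
    ([quotient_length_ideal_smul_seq]), and
    [l(M / (y_1^t, ..., y_d^t) M) <= t^d l(M / (y_1, ..., y_d) M)]
    ([quotient_length_exp]). Since [e(I(j); M) = 0], the length of [M / L] is
    [o(t^d)] for each [s], whence [P(n + s e_j) <= l(M / (y_1, ..., y_d) M) + d],
    whatever [s].

    Both length estimates follow from the subadditivity of length along a linear
    map ([quotient_length_linear]). The number of parameters must be the
    dimension [d], for otherwise [t^d] would be replaced by a larger power; such
    parameters are found by prime avoidance ([system_of_parameters]), and the
    quotient that they define has finite length ([finite_length_radical]). *)

Set Implicit Arguments.
Unset Strict Implicit.
Unset Printing Implicit Defensive.

Import Order.TTheory GRing.Theory Num.Theory.
Local Open Scope classical_set_scope.
Local Open Scope ring_scope.

(** * Submodules *)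

Section SubmoduleOperations.
Context {R : comNzRingType} {V : lmodType R}.
Implicit Types (J : set R) (L N : set V).

Lemma mem_ideal_smul J L a u : J a -> L u -> ideal_smul J L (a *: u).
Proof. by move=> Ja Lu; apply: sub_gen_smallest; exists a => //; exists u. Qed.

Lemma ideal_smul_sub J L N : is_submodule N ->
  (forall a u, J a -> L u -> N (a *: u)) -> ideal_smul J L `<=` N.
Proof.
by move=> sN JLN; apply: smallest_sub => // _ [a Ja [u Lu <-]]; exact: JLN.
Qed.

Lemma ideal_smul_submodule J L : is_submodule (ideal_smul J L).
Proof. exact: generated_submodule. Qed.

Lemma ideal_smulS J J' L : J `<=` J' -> ideal_smul J L `<=` ideal_smul J' L.
Proof.
move=> JJ'; apply: ideal_smul_sub; first exact: ideal_smul_submodule.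
by move=> a u /JJ' J'a; exact: mem_ideal_smul.
Qed.

Lemma ideal_smul_generated (S : set R) L : is_submodule L ->
  ideal_smul (generated (V := R^o) S : set R) L = ideal_smul S L.
Proof.
move=> sL; apply/seteqP; split; last by apply: ideal_smulS; exact: sub_gen_smallest.
apply: ideal_smul_sub => [|a u + Lu]; first exact: ideal_smul_submodule.
have [N0 NZD] := ideal_smul_submodule S L.
pose W := [set b : R^o | ideal_smul S L ((b : R) *: u)].
suff : generated (V := R^o) S `<=` W by apply.
apply: smallest_sub => [|b Sb]; last exact: mem_ideal_smul.
by split=> [|b v w Wv Ww]; rewrite /W /= ?scale0r // scalerDl -scalerA; exact: NZD.
Qed.

Lemma linear_map0 (U : lmodType R) (f : U -> V) : linear f -> f 0 = 0.
Proof.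
move=> linf.
by have := linf (-1) 0 0; rewrite !scaleN1r !addNr.
Qed.

(** The submodule [N + f U]. *)
Definition add_image {U : lmodType R} N (f : U -> V) : set V :=
  [set w | exists2 v, N v & exists u, w = v + f u].

Lemma add_image_submodule (U : lmodType R) N (f : U -> V) :
  is_submodule N -> linear f -> is_submodule (add_image N f).
Proof.
move=> [N0 NZD] linf; have f0 := linear_map0 linf.
split=> [|a _ _ [v Nv [u ->]] [v' Nv' [u' ->]]].
  by exists 0 => //; exists 0; rewrite f0 addr0.
exists (a *: v + v'); first exact: NZD.
by exists (a *: u + u'); rewrite linf scalerDr addrACA.
Qed.

Lemma sub_add_image (U : lmodType R) N (f : U -> V) :
  linear f -> N `<=` add_image N f.
Proof.
move=> linf v Nv; exists v => //; exists 0.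
by rewrite (linear_map0 linf) addr0.
Qed.

Lemma image_sub_add (U : lmodType R) N (f : U -> V) u :
  is_submodule N -> add_image N f (f u).
Proof. by move=> [N0 _]; exists 0 => //; exists u; rewrite add0r. Qed.

Lemma linear_scale (x : R) : linear (fun u : V => x *: u).
Proof. by move=> a u v; rewrite scalerDr !scalerA mulrC. Qed.

Lemma linear_line (v : V) : linear (fun a : R^o => (a : R) *: v).
Proof. by move=> a u w; rewrite scalerDl scalerA. Qed.

End SubmoduleOperations.

(** * Length *)

Section Length.
Context {K : realType} {R : comNzRingType}.
Implicit Types V : lmodType R.

Lemma chain_quotient_length V (N : set V) n :
  submodule_chain N n -> (n%:R%:E <= quotient_length K N)%E.
Proof. by move=> Nn; apply: ereal_sup_ubound; exists n. Qed.

Lemma quotient_length_leP V (N : set V) (b : \bar K) :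
  (forall n, submodule_chain N n -> (n%:R%:E <= b)%E) ->
  (quotient_length K N <= b)%E.
Proof. by move=> Nb; apply: ge_ereal_sup => _ [n Nn <-]; exact: Nb. Qed.

Lemma quotient_length_ge0 V (N : set V) : is_submodule N ->
  (0 <= quotient_length K N)%E.
Proof.
by move=> sN; apply: (@chain_quotient_length _ N 0%N); exists (fun=> N); split.
Qed.

Lemma quotient_lengthS V (N N' : set V) : N `<=` N' ->
  (quotient_length K N' <= quotient_length K N)%E.
Proof.
move=> NN'; apply: quotient_length_leP => n [C [sC N'C ltC]].
by apply: chain_quotient_length; exists C; split=> //; exact: subset_trans N'C.
Qed.

Lemma quotient_lengthT V : (quotient_length K [set: V] <= 0)%E.
Proof.
apply: quotient_length_leP => -[//|n] [C [sC TC]] /(_ 0%N isT) [_].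
by case=> v _; exact: TC.
Qed.

(** A weakly increasing chain refines to a strictly increasing one by dropping
    its repetitions. *)
Lemma strict_subchain V (C : nat -> set V) n :
  (forall i, is_submodule (C i)) ->
  (forall i, (i < n)%N -> C i `<=` C i.+1) ->
  submodule_chain (C 0%N) (\sum_(i < n) `[< C i <> C i.+1 >]).
Proof.
move=> sC incC.
suff [D [sD [C0D [Dlast ltD]]]] : exists D : nat -> set V,
    (forall i, is_submodule (D i)) /\ C 0%N `<=` D 0%N /\
    D (\sum_(i < n) `[< C i <> C i.+1 >])%N = C n /\
    forall i, (i < \sum_(i < n) `[< C i <> C i.+1 >])%N -> D i `<` D i.+1.
  by exists D; split=> //; exact: ltD.
elim: n incC => [|n IHn] incC.
  by exists (fun=> C 0%N); do 3![split=> //] => i; rewrite big_ord0.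
have {IHn} [i lt_in|D [sD [C0D [Dlast ltD]]]] := IHn.
  by apply: incC; exact: ltnW.
rewrite big_ord_recr /=; set k := (\sum_(i < n) _)%N in Dlast ltD *.
case: asboolP => [neqC|/contrapT eqC]; last first.
  by exists D; rewrite addn0 -eqC; do 3![split=> //].
exists (fun i => if (i <= k)%N then D i else C n.+1); split=> [i|].
  by case: ifP.
split; first exact: subset_trans C0D _.
rewrite addn1 ltnn; split=> // i.
rewrite ltnS => le_ik; rewrite le_ik; move: le_ik.
rewrite leq_eqVlt => /orP[/eqP ->|lt_ik].
  rewrite ltnn /= Dlast; split; first exact: incC.
  by move=> geC; apply: neqC; apply/seteqP; split=> //; exact: incC.
by rewrite lt_ik; exact: ltD.
Qed.

(** Subadditivity of length along [U / L --f--> V / N --> V / (N + f U)]. A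
    chain of submodules [C i] above [N] induces the chains [C i + f U] and
    [f @^-1` C i]; by the modular law, each strict step of [C] is strict in at
    least one of them. *)
Lemma quotient_length_linear {U V : lmodType R} {L : set U} {N N' : set V}
    {f : U -> V} : linear f ->
  (forall u, L u -> N (f u)) ->
  N' `<=` add_image N f ->
  (quotient_length K N <= quotient_length K N' + quotient_length K L)%E.
Proof.
move=> linf LN N'N; apply: quotient_length_leP => n [C [sC NC ltC]].
have f0 := linear_map0 linf.
pose D i := add_image (C i) f.
pose E i := f @^-1` C i.
have sD i : is_submodule (D i) by exact: add_image_submodule.
have sE i : is_submodule (E i).
  split; first by rewrite /E /= f0; case: (sC i).
  by move=> a u u' Eu Eu'; rewrite /E /= linf; exact: (sC i).2.
have incC i : (i < n)%N -> C i `<=` C i.+1 by move=> /ltC [].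
have incD i : (i < n)%N -> D i `<=` D i.+1.
  by move=> /incC CC w [v /CC Cv [u ->]]; exists v => //; exists u.
have incE i : (i < n)%N -> E i `<=` E i.+1 by move=> /incC CC u /CC.
pose p := (\sum_(i < n) `[< D i <> D i.+1 >])%N.
pose q := (\sum_(i < n) `[< E i <> E i.+1 >])%N.
have le_npq : (n <= p + q)%N.
  rewrite -[X in (X <= _)%N]card_ord -sum1_card -big_split /=.
  apply: leq_sum => i _; do 2![case: asboolP => //] => /contrapT eqE /contrapT eqD.
  have [_ []] := ltC i (ltn_ord i) => w Cw.
  have [v Cv [u def_w]] : D i w by rewrite eqD; exact: sub_add_image.
  have : E i.+1 u.
    rewrite /E /= (_ : f u = w - v); last by rewrite def_w addrC addKr.
    by apply: submoduleB => //; exact: incC.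
  by rewrite -eqE def_w => Eu; exact: submoduleD.
apply: (@le_trans _ _ (p%:R%:E + q%:R%:E)%E).
  by rewrite -EFinD -natrD lee_fin ler_nat.
apply: leeD.
  apply: le_trans (chain_quotient_length (strict_subchain sD incD)) _.
  apply: quotient_lengthS => w /N'N [v /NC Cv [u ->]].
  by exists v => //; exists u.
apply: le_trans (chain_quotient_length (strict_subchain sE incE)) _.
by apply: quotient_lengthS => u /LN; exact: NC.
Qed.

End Length.

Section LengthBounds.
Context {K : realType} {R : comNzRingType} {V : lmodType R}.
Implicit Types (J : set R) (L N : set V) (xs : seq R) (a b : K).

(** The map [V^k -> V / L'], with [L' = x_1 L + ... + x_k L], given by
    [x_1, ..., x_k] kills [L^k], and the cokernel is [V / (x_1, ..., x_k) V].
    The bound depends on [L] through its colength only, whatever the number of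
    generators of [L]. *)
Lemma quotient_length_ideal_smul_seq L xs a b :
  (quotient_length K (ideal_smul [set` xs] [set: V]) <= a%:E)%E ->
  (quotient_length K L <= b%:E)%E ->
  (quotient_length K (ideal_smul [set` xs] L) <= (a + b *+ size xs)%:E)%E.
Proof.
pose addx N x := add_image N (fun u : V => x *: u).
have addxs N : is_submodule N -> is_submodule (foldl addx N xs) /\
    forall w, N w \/ (exists2 x, x \in xs & exists u : V, w = x *: u) ->
    foldl addx N xs w.
  elim: xs N => [|x xs IHxs] N sN /=; first by split=> // w [//|[]].
  have [|sNx Nxw] := IHxs (addx N x).
    by apply: add_image_submodule => //; exact: linear_scale.
  split=> // w [Nw|[y xs_y [u ->]]]; apply: Nxw.
    by left; apply: sub_add_image => //; exact: linear_scale.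
  move: xs_y; rewrite inE => /orP[/eqP ->|xs_y]; last first.
    by right; exists y => //; exists u.
  by left; exact: (image_sub_add (fun v : V => x *: v)).
move=> lea leb; have := ideal_smul_submodule [set` xs] L.
have : forall x u, x \in xs -> L u -> ideal_smul [set` xs] L (x *: u).
  by move=> x u xs_x Lu; exact: mem_ideal_smul.
have : (quotient_length K (foldl addx (ideal_smul [set` xs] L) xs) <= a%:E)%E.
  have [sN Nw] := addxs _ (ideal_smul_submodule [set` xs] L).
  apply: le_trans lea; apply: quotient_lengthS.
  apply: ideal_smul_sub => // x u xs_x _; apply: Nw.
  by right; exists x => //; exists u.
move: (ideal_smul _ L) => N {lea}.
elim: xs {addxs} N => [|x xs IHxs] N /= lea LN sN; first by rewrite mulr0n addr0.
have -> : a + b *+ (size xs).+1 = (a + b *+ size xs) + b by rewrite mulrSr addrA.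
have Nx v : N v -> addx N x v.
  by move=> Nv; apply: sub_add_image => //; exact: linear_scale.
apply: le_trans (quotient_length_linear (N' := addx N x) (L := L)
                   (linear_scale x) _ _) _ => //.
  by move=> u; apply: LN; rewrite mem_head.
rewrite EFinD; apply: leeD => //; apply: IHxs => //.
  by move=> y u xs_y Lu; apply: Nx; apply: LN => //; rewrite inE xs_y orbT.
by apply: add_image_submodule => //; exact: linear_scale.
Qed.

(** Multiplication by [x] maps [V / (x^t, J) V] onto the kernel of
    [V / (x^(t + 1), J) V -> V / (x, J) V]. *)
Lemma quotient_length_exp1 J x a t :
  (quotient_length K (ideal_smul (x |` J) [set: V]) <= a%:E)%E ->
  (quotient_length K (ideal_smul ((x ^+ t)%R |` J) [set: V]) <= (a *+ t)%:E)%E.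
Proof.
move=> lea; elim: t => [|t IHt].
  apply: le_trans (quotient_lengthT V); apply: quotient_lengthS => v _.
  by rewrite -[v]scale1r; apply: mem_ideal_smul => //; left; rewrite /= expr0.
rewrite mulrS EFinD; apply: le_trans (leeD lea IHt).
apply: (quotient_length_linear (linear_scale x)) => [u|w].
  move=> Nu; pose P := [set u | ideal_smul (x ^+ t.+1 |` J) [set: V] (x *: u)].
  suff : ideal_smul (x ^+ t |` J) [set: V] `<=` P by move=> /(_ u Nu).
  have [N0 NZD] := ideal_smul_submodule (x ^+ t.+1 |` J) [set: V].
  apply: ideal_smul_sub => [|y v Jy _].
    split=> [|c v w]; rewrite /P /= ?scaler0 // linear_scale; exact: NZD.
  rewrite /P /=; case: Jy => [->|Jy].
    by rewrite scalerA -exprS; apply: mem_ideal_smul => //; left.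
  rewrite scalerA mulrC -scalerA.
  by apply: mem_ideal_smul => //; right.
suff : ideal_smul (x |` J) [set: V] `<=`
    add_image (ideal_smul (x ^+ t.+1 |` J) [set: V]) (fun u : V => x *: u) by exact.
apply: ideal_smul_sub => [|y v [->|Jy] _].
- apply: add_image_submodule; last exact: linear_scale.
  exact: ideal_smul_submodule.
- exact/(image_sub_add (fun v : V => x *: v))/ideal_smul_submodule.
- apply: sub_add_image; first exact: linear_scale.
  by apply: mem_ideal_smul => //; right.
Qed.

(** The set [J] holds the powers that have already replaced their bases. *)
Lemma quotient_length_exp_seq J xs a t :
  (quotient_length K (ideal_smul ([set` xs] `|` J) [set: V]) <= a%:E)%E ->
  (quotient_length K
     (ideal_smul ([set` [seq (x ^+ t)%R | x <- xs]] `|` J) [set: V])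
   <= (a *+ t ^ size xs)%:E)%E.
Proof.
elim: xs J a => [|x xs IHxs] J a lea /=; first by rewrite expn0 mulr1n.
have cons_setU (y : R) (s : seq R) (A : set R) :
    [set` y :: s] `|` A = [set` s] `|` (y |` A).
  apply/seteqP; split=> z; rewrite /= inE.
    by move=> [/orP[/eqP ->|sz]|Az]; [right; left|left|right; right].
  move=> [sz|[->|Az]]; last by right.
    by left; rewrite sz orbT.
  by left; rewrite eqxx.
rewrite cons_setU expnS mulrnA; apply: IHxs.
by rewrite setUCA; apply: quotient_length_exp1; rewrite setUCA -cons_setU.
Qed.

Lemma quotient_length_exp xs a t :
  (quotient_length K (ideal_smul [set` xs] [set: V]) <= a%:E)%E ->
  (quotient_length K (ideal_smul [set` [seq (x ^+ t)%R | x <- xs]] [set: V])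
   <= (a *+ t ^ size xs)%:E)%E.
Proof.
by move=> lea; rewrite -[X in ideal_smul X]setU0 quotient_length_exp_seq ?setU0.
Qed.

End LengthBounds.

(** * Systems of parameters *)

Section NoetherianRings.
Context {R : comNzRingType}.
Implicit Types (A J P Q : set R) (s : seq (set R)) (xs : seq R).

Lemma is_ideal0 J : is_ideal J -> J 0.
Proof. by case. Qed.

Lemma noetherian_ind (T : set R -> Prop) : noetherian R ->
  (forall J, is_ideal J -> (forall J', is_ideal J' -> J `<` J' -> T J') -> T J) ->
  forall J, is_ideal J -> T J.
Proof.
move=> hR Tind J0 idJ0; apply: contrapT => nTJ0.
have /choice[g gP] : forall J, exists J', is_ideal J /\ ~ T J ->
    [/\ is_ideal J', ~ T J' & J `<` J'].
  move=> J; have [[idJ nTJ]|] := pselect (is_ideal J /\ ~ T J); last by exists J.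
  apply: contrapT => noJ'; apply: nTJ; apply: Tind => // J' idJ' ltJJ'.
  by apply: contrapT => nTJ'; apply: noJ'; exists J'.
pose C n := iter n g J0.
have CP n : is_ideal (C n) /\ ~ T (C n) by elim: n => [//|n /gP[]].
have ltC n : C n `<` C n.+1 by have [] := gP _ (CP n).
have incC i k : (i <= k)%N -> C i `<=` C k.
  move=> /subnK <-; elim: (k - i)%N => [//|n IHn].
  by apply: subset_trans IHn _; case: (ltC (n + i)%N).
pose U := \bigcup_n C n.
have idU : is_ideal U.
  split=> [|a u v [i _ Ciu] [k _ Ckv]]; first by exists 0%N => //; exact: is_ideal0.
  exists (maxn i k) => //; apply: (CP _).1.2.
    by apply: incC Ciu; rewrite leq_maxl.
  by apply: incC Ckv; rewrite leq_maxr.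
have [s defU] := hR _ idU.
have [N sN] : exists N, [set` s] `<=` C N.
  have : [set` s] `<=` U by rewrite defU; exact: sub_gen_smallest.
  elim: s {defU} => [|x s IHs] sU; first by exists 0%N.
  have [|N sN] := IHs; first by move=> y sy; apply: sU; rewrite /= inE sy orbT.
  have [|k _ Ckx] := sU x; first by rewrite /= mem_head.
  exists (maxn N k) => y; rewrite /= inE => /orP[/eqP ->|sy].
    by apply: incC Ckx; rewrite leq_maxr.
  by apply: incC (sN y sy); rewrite leq_maxl.
have [_ []] := ltC N => x CNx; have : U x by exists N.+1.
by rewrite defU; apply; split=> //; exact: (CP N).1.
Qed.

Definition add_principal J x : set R :=
  [set z | exists2 y, J y & exists a, z = y + a * x].

Lemma add_principal_ideal J x : is_ideal J -> is_ideal (add_principal J x).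
Proof. by move=> idJ; apply: (add_image_submodule (V := R^o)) (linear_line _). Qed.

Lemma lt_add_principal J x : is_ideal J -> ~ J x -> J `<` add_principal J x.
Proof.
move=> idJ nJx; split=> [y Jy|/(_ x) leJ].
  by exists y => //; exists 0; rewrite mul0r addr0.
by apply/nJx/leJ; exists 0; [exact: is_ideal0|exists 1; rewrite mul1r add0r].
Qed.

(** A form of the finiteness of the set of minimal primes of [J]: some finite
    set of primes contains all of them, and its intersection is the radical.
    An ideal maximal among counterexamples is proper and not prime; if it
    contains [x * y] but neither [x] nor [y], the lists of primes of [J + (x)]
    and [J + (y)] together serve for [J]. *)
Lemma noetherian_primes J : noetherian R -> is_ideal J ->
  exists s, [/\ forall P, P \in s -> is_prime_ideal P /\ J `<=` P,
    forall Q, is_prime_ideal Q -> J `<=` Q -> exists2 P, P \in s & P `<=` Q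
    & forall z, (forall P, P \in s -> P z) -> radical J z].
Proof.
move=> hR; move: J; apply: noetherian_ind => // J idJ IHJ.
have [J1|nJ1] := pselect (J 1).
  have JT z : J z by rewrite -[z]mulr1; exact: is_idealM.
  exists [::]; split=> // [Q [_ neqQ _] JQ|z _]; last by exists 1%N; exact: JT.
  by case: neqQ; apply/seteqP; split=> // z _; exact: JQ.
have [primeJ|nprimeJ] := pselect (is_prime_ideal J).
  exists [:: J]; split=> [P|Q _ JQ|z Pz].
  - by rewrite inE => /eqP ->; split.
  - by exists J => //; rewrite mem_head.
  - by exists 1%N; exact: Pz (mem_head _ _).
have [x [y [Jxy nJx nJy]]] : exists x y, [/\ J (x * y), ~ J x & ~ J y].
  apply: contrapT => noxy; apply: nprimeJ; split=> // [JT|x y Jxy].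
    by apply: nJ1; rewrite JT.
  by apply: contrapT => /not_orP[nJx nJy]; apply: noxy; exists x, y.
have [sx [primex ltx radx]] := IHJ _ (add_principal_ideal x idJ) (lt_add_principal idJ nJx).
have [sy [primey lty rady]] := IHJ _ (add_principal_ideal y idJ) (lt_add_principal idJ nJy).
have leJ t : J `<=` add_principal J t.
  by move=> z Jz; exists z => //; exists 0; rewrite mul0r addr0.
exists (sx ++ sy); split=> [P|Q primeQ JQ|z sPz].
- rewrite mem_cat => /orP[/primex|/primey] [primeP leP]; split=> //;
  exact: subset_trans leP.
- have [idQ _ /(_ x y (JQ _ Jxy)) Qxy] := primeQ.
  have leQ t : Q t -> add_principal J t `<=` Q.
    move=> Qt _ [u Ju [a ->]]; apply: is_idealD => //; first exact: JQ.
    exact: is_idealM.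
  case: Qxy => [/leQ/(ltx _ primeQ)|/leQ/(lty _ primeQ)] [P sP PQ]; exists P => //;
  by rewrite mem_cat sP ?orbT.
- have [|k [u Ju [a zk]]] := radx z.
    by move=> P sP; apply: sPz; rewrite mem_cat sP.
  have [|l [v Jv [b zl]]] := rady z.
    by move=> P sP; apply: sPz; rewrite mem_cat sP orbT.
  exists (k + l)%N; rewrite exprD zk zl.
  have -> : (u + a * x) * (v + b * y) =
    (v + b * y) * u + ((a * x) * v + (a * b) * (x * y)) by ring.
  by do 2![apply: is_idealD => //; first exact: is_idealM]; exact: is_idealM.
Qed.

Lemma prime_avoidance A s : is_ideal A ->
  (forall P, P \in s -> is_prime_ideal P /\ ~ A `<=` P) ->
  exists2 a, A a & forall P, P \in s -> ~ P a.
Proof.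
move=> idA; have [n] := ubnP (size s); elim: n s => // n IHn [|P s] les sP.
  by exists 0; first exact: is_ideal0.
have [primeP nAP] := sP _ (mem_head _ _); have [idP _ mulP] := primeP.
have [[Q sQ QP]|noQ] := pselect (exists2 Q, Q \in s & Q `<=` P).
  have perms : perm_eq s (Q :: rem Q s) by exact: perm_to_rem.
  (* Avoiding [P] entails avoiding [Q]. *)
  have [||a Aa Pa] := IHn (P :: rem Q s).
  - by move: les; rewrite /= (perm_size perms).
  - move=> P'; rewrite inE => /orP[/eqP ->|]; first by split.
    by move=> /mem_rem sP'; apply: sP; rewrite inE sP' orbT.
  exists a => // P'; rewrite inE (perm_mem perms) inE => /or3P[/eqP ->|/eqP ->|P's].
  - by apply: Pa; exact: mem_head.
  - by move=> /QP; apply: Pa; exact: mem_head.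
  - by apply: Pa; rewrite inE P's orbT.
have [||a Aa sa] := IHn s => [//|Q sQ|]; first by apply: sP; rewrite inE sQ orbT.
have [Pa|nPa] := pselect (P a); last first.
  by exists a => // Q; rewrite inE => /orP[/eqP ->|/sa].
(* Then [a + b] is outside [P] and the primes of [s], for any [b] as below: the
   product of an element of [A] outside [P] and, for each [Q] in [s], of an
   element of [Q] outside [P]. *)
have [b [Ab nPb sb]] : exists b, [/\ A b, ~ P b & forall Q, Q \in s -> Q b].
  have : forall Q, Q \in s -> is_ideal Q /\ exists2 x, Q x & ~ P x.
    move=> Q sQ; have [|[idQ _ _] _] := sP Q; first by rewrite inE sQ orbT.
    split=> //; apply: contrapT => nox; apply: noQ; exists Q => // x Qx.
    by apply: contrapT => nPx; apply: nox; exists x.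
  elim: (s) => [_|Q s' IHs sQ].
    have [b [Ab nPb]] : exists b, A b /\ ~ P b.
      apply: contrapT => nob; apply: nAP => b Ab.
      by apply: contrapT => nPb; apply: nob; exists b.
    by exists b; split.
  have [Q' sQ'|b [Ab nPb sb]] := IHs; first by apply: sQ; rewrite inE sQ' orbT.
  have [idQ [x Qx nPx]] := sQ Q (mem_head _ _).
  exists (x * b); split=> [||Q']; first exact: is_idealM.
    by case/mulP.
  rewrite inE => /orP[/eqP ->|s'Q']; first by rewrite mulrC; exact: is_idealM.
  apply: is_idealM; last exact: sb.
  by have [|//] := sQ Q'; rewrite inE s'Q' orbT.
exists (a + b); first exact: is_idealD.
move=> Q; rewrite inE => /orP[/eqP -> Pab|sQ Qab].
  by apply: nPb; rewrite -[b](addKr a) addrC; exact: is_idealB.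
have [|[idQ _ _] _] := sP Q; first by rewrite inE sQ orbT.
by apply: (sa _ sQ); rewrite -[a](addrK b); apply: is_idealB => //; exact: sb.
Qed.

End NoetherianRings.

Section LocalRings.
Context {R : comNzRingType}.
Implicit Types (m A J P Q : set R) (xs : seq R).

Lemma maximal_ideal_prime m : is_maximal_ideal m -> is_prime_ideal m.
Proof.
move=> [idm neqm maxm]; split=> // x y mxy; apply: contrapT => /not_orP[nmx nmy].
have lemx := lt_add_principal idm nmx.
have [eqm|eqT] := maxm _ (add_principal_ideal x idm) (proj1 lemx).
  by case: lemx => _; apply; rewrite eqm.
have : add_principal m x 1 by rewrite eqT.
case=> u mu [a def1]; apply: nmy; rewrite -[y]mul1r def1 mulrDl mulrC -mulrA.
by apply: is_idealD => //; exact: is_idealM.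
Qed.

Lemma local_ideal_sub m J : noetherian R -> local_ring m ->
  is_ideal J -> J <> setT -> J `<=` m.
Proof.
move=> hR [_ uniqm]; move: J; apply: noetherian_ind => // J idJ IHJ neqJ.
have [maxJ|nmaxJ] := pselect (is_maximal_ideal J); first by rewrite (uniqm J).
have [J' [idJ' ltJ neqJ']] : exists J', [/\ is_ideal J', J `<` J' & J' <> setT].
  apply: contrapT => noJ'; apply: nmaxJ; split=> // J' idJ' leJ.
  have [|neqJ'] := pselect (J' = setT); first by right.
  left; apply/seteqP; split=> //; apply: contrapT => nleJ'.
  by apply: noJ'; exists J'.
by apply: subset_trans (IHJ J' idJ' ltJ neqJ'); case: ltJ.
Qed.

Definition height_ge Q (n : nat) : Prop :=
  exists P : nat -> set R, [/\ forall i, (i <= n)%N -> is_prime_ideal (P i),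
    P n = Q & forall i, (i < n)%N -> P i `<` P i.+1].

Lemma height_ge_lt P Q n : height_ge P n -> is_prime_ideal Q -> P `<` Q ->
  height_ge Q n.+1.
Proof.
move=> [C [primeC Cn ltC]] primeQ ltPQ.
exists (fun i => if (i <= n)%N then C i else Q); split=> [i _||i].
- by case: ifP => // /primeC.
- by rewrite ltnn.
- rewrite ltnS => le_in; rewrite le_in; case: ltnP => [/ltC //|ge_in].
  by have -> : i = n by [apply/eqP; rewrite eqn_leq le_in]; rewrite Cn.
Qed.

Lemma height_ge_prime_chain Q n : height_ge Q n -> prime_chain [set 0 : R] n.
Proof.
move=> [C [primeC _ ltC]]; exists C; split=> // _ ->.
by have [[]] := primeC 0%N isT.
Qed.

(** Existence of systems of parameters. By prime avoidance, each [x_i] can be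
    chosen in [m] outside every prime other than [m] that is minimal over
    [(x_1, ..., x_(i-1))]; then any prime other than [m] that contains
    [x_1, ..., x_i] has height at least [i]. For [i = d] there is no such prime,
    as the height of [m] would exceed [d]. *)
Lemma system_of_parameters m d : noetherian R -> local_ring m ->
  krull_dim_eq R d ->
  exists xs, [/\ size xs = d, [set` xs] `<=` m
    & m `<=` radical (generated (V := R^o) [set` xs])].
Proof.
move=> hR hm [_ dimR]; have [maxm _] := hm; have primem := maximal_ideal_prime maxm.
have [idm neqm _] := maxm.
have lem Q : is_prime_ideal Q -> Q `<=` m.
  by case=> idQ neqQ _; exact: local_ideal_sub.
have in_gen xs : [set` xs] `<=` generated (V := R^o) [set` xs].
  exact: sub_gen_smallest.
have idgen xs : is_ideal (generated (V := R^o) [set` xs]).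
  exact: generated_submodule.
have [xs [sizexs xsm ht]] : exists xs, [/\ size xs = d, [set` xs] `<=` m
    & forall Q, is_prime_ideal Q -> [set` xs] `<=` Q -> Q <> m -> height_ge Q d].
  elim: (d) => [|n [xs [sizexs xsm ht]]].
    by exists [::]; split=> // Q primeQ _ _; exists (fun=> Q).
  have [s [primes sQ _]] := noetherian_primes hR (idgen xs).
  have [|a ma sa] := prime_avoidance (s := [seq P <- s | P != m]) idm.
    move=> P; rewrite mem_filter => /andP[/eqP neqP /primes[primeP _]].
    by split=> // leP; apply: neqP; apply/seteqP; split=> //; exact: lem.
  exists (a :: xs); split=> [|x|Q primeQ xsQ neqQ]; first by rewrite /= sizexs.
    by rewrite /= inE => /orP[/eqP ->|/xsm].
  have [|P sP PQ] := sQ Q primeQ.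
    apply: smallest_sub => [|x xs_x]; first by case: primeQ.
    by apply: xsQ; rewrite /= inE xs_x orbT.
  have neqP : P <> m.
    move=> eqP; apply: neqQ; apply/seteqP; split; first exact: lem.
    by rewrite -eqP.
  have [primeP xsP] := primes P sP.
  apply: (@height_ge_lt P) => //.
    apply: ht => // x xs_x; apply: xsP; exact: in_gen.
  split=> // QP; apply: (sa P); first by rewrite mem_filter sP andbT; apply/eqP.
  by apply: QP; apply: xsQ; exact: mem_head.
exists xs; split=> // z mz.
have [s [primes _]] := noetherian_primes hR (idgen xs); apply=> P /primes[primeP xsP].
have [-> //|neqP] := pselect (P = m).
have /height_ge_lt/(_ primem) : height_ge P d.
  by apply: ht => // x xs_x; apply: xsP; exact: in_gen.
have [ltPm|] := pselect (P `<` m).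
  by move=> /(_ ltPm)/height_ge_prime_chain/dimR; rewrite ltnn.
move=> nlt; case: nlt; split; first exact: lem.
by move=> mP; apply: neqP; apply/seteqP; split=> //; exact: lem.
Qed.

End LocalRings.

(** * Finite length *)

Section FiniteLength.
Context {K : realType} {R : comNzRingType} {V : lmodType R}.
Implicit Types (m J : set R) (N : set V) (xs : seq R).

Lemma quotient_length_maximal m : is_maximal_ideal m ->
  (quotient_length K (m : set R^o) <= 1%:E)%E.
Proof.
move=> [_ neqm maxm]; apply: quotient_length_leP => -[|[|n]] [C [sC mC ltC]].
- by rewrite lee_fin ler01.
- by [].
have [C01 nC01] := ltC 0%N isT; have [C12 nC12] := ltC 1%N isT.
have [eqC|eqC] := maxm (C 1%N) (sC 1%N) (subset_trans mC C01).
  by case: nC01; rewrite eqC.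
by case: nC12; rewrite eqC.
Qed.

(** Adjoining the generators [u] of [V] to [m V] one at a time, each step has
    length at most that of [R / m], which maps onto it by [a |-> a u]. *)
Lemma quotient_length_maximal_smul m : is_maximal_ideal m ->
  finitely_generated [set: V] ->
  exists b : K, (quotient_length K (ideal_smul m [set: V]) <= b%:E)%E.
Proof.
move=> maxm [us gen_us]; exists (size us)%:R.
have : forall W, is_submodule W -> [set` us] `<=` W -> ideal_smul m [set: V] `<=` W ->
    W = setT.
  move=> W sW usW _; apply/seteqP; split=> //; rewrite gen_us.
  exact: smallest_sub.
have : forall a u, m a -> ideal_smul m [set: V] (a *: u).
  by move=> a u ma; exact: mem_ideal_smul.
have := ideal_smul_submodule m [set: V]; move: (ideal_smul m _) => N.
elim: us {gen_us} N => [|u us IHus] N sN mN genN.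
  have -> : N = setT by apply: genN.
  exact: quotient_lengthT.
rewrite /= mulrSr EFinD.
pose N' := add_image N (fun a : R^o => a *: u).
have sN' : is_submodule N' by apply: add_image_submodule => //; exact: linear_line.
have NN' : N `<=` N' by apply: sub_add_image; exact: linear_line.
apply: le_trans (quotient_length_linear (N' := N') (L := (m : set R^o))
                   (linear_line u) _ _) _ => // [a ma|]; first exact: mN.
apply: leeD; last exact: quotient_length_maximal.
apply: IHus => // [a v ma|W sW usW N'W]; first by apply: NN'; exact: mN.
apply: genN => // [v|]; last exact: subset_trans N'W.
rewrite /= inE => /orP[/eqP ->|]; last exact: usW.
apply: N'W; rewrite -[u]scale1r.
exact: (image_sub_add (fun a : R^o => a *: u)).
Qed.

Lemma seq_exp_radical m xs : is_ideal m ->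
  (forall x, x \in xs -> radical m x) -> exists n, forall x, x \in xs -> m (x ^+ n).
Proof.
move=> idm; elim: xs => [|x xs IHxs] radxs; first by exists 0%N.
have [y xs_y|n mn] := IHxs; first by apply: radxs; rewrite inE xs_y orbT.
have [k mk] := radxs x (mem_head _ _).
exists (n + k)%N => y; rewrite exprD inE => /orP[/eqP ->|/mn mny].
  exact: is_idealM.
by rewrite mulrC; exact: is_idealM.
Qed.

(** For generators [z_1, ..., z_k] of [m] and some [n], the ideal [J] contains
    [z_1^n, ..., z_k^n], and the length of [V / (z_1^n, ..., z_k^n) V] is at most
    [n^k] times that of [V / m V]. *)
Lemma finite_length_radical m J : noetherian R -> is_maximal_ideal m ->
  finitely_generated [set: V] -> is_ideal J -> m `<=` radical J ->
  exists b : K, (quotient_length K (ideal_smul J [set: V]) <= b%:E)%E.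
Proof.
move=> hR maxm fgV idJ mJ; have [idm _ _] := maxm.
have [zs defm] : exists zs : seq R, m = generated (V := R^o) [set` zs].
  exact: hR.
have zsm : [set` zs] `<=` m by rewrite defm; exact: sub_gen_smallest.
have [n Jzs] : exists n, forall z, z \in zs -> J (z ^+ n).
  by apply: seq_exp_radical => // z /zsm /mJ.
have [b leb] := quotient_length_maximal_smul maxm fgV.
exists (b *+ n ^ size zs).
apply: le_trans (quotient_length_exp (xs := zs) n _).
  apply: quotient_lengthS; apply: ideal_smulS => y /mapP[z zs_z ->].
  exact: Jzs.
by rewrite -(ideal_smul_generated [set` zs]) // -defm.
Qed.

End FiniteLength.

(** * Bounded polynomials *)

Section BoundedPolynomials.
Context {K : realType}.

Lemma bounded_poly_coef_eq0 (p : {poly K}) (N : nat) (C : K) :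
  (forall s : nat, (N <= s)%N -> 0 <= p.[s%:R] <= C) ->
  forall k, (0 < k)%N -> p`_k = 0.
Proof.
move=> bndp; suff size_p : (size p <= 1)%N.
  by move=> k k0; rewrite nth_default //; exact: leq_trans k0.
rewrite leqNgt; apply/negP => lt1p.
have eventually (q : {poly K}) : 0 < lead_coef q ->
    exists2 s : nat, (N <= s)%N & 0 < q.[s%:R].
  move=> lq; have [x qx] := polyrcf.poly_pinfty_gt_lc lq.
  exists (maxn N (Num.bound `|x|)); first by rewrite leq_maxl.
  apply: lt_le_trans lq (qx _ _); apply: le_trans (ler_norm x) _.
  apply: le_trans (ltW (archi_boundP _)) _ => //.
  by rewrite ler_nat leq_maxr.
have : lead_coef p != 0 by rewrite lead_coef_eq0 -size_poly_gt0 ltnW.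
rewrite neq_lt => /orP[neg|pos].
  have [|s Ns] := eventually (- p); first by rewrite lead_coefN oppr_gt0.
  by rewrite hornerN oppr_gt0 ltNge; case/andP: (bndp s Ns) => ->.
have [|s Ns] := eventually (p - C%:P).
  by rewrite lead_coefDl // size_polyN (leq_ltn_trans (size_polyC_leq1 _)).
by rewrite hornerD hornerN hornerC subr_gt0 ltNge; case/andP: (bndp s Ns) => _ ->.
Qed.

Lemma digits_inj (B r : nat) (f g : 'I_r -> nat) :
  (forall i, (f i < B)%N) -> (forall i, (g i < B)%N) ->
  (\sum_(i < r) f i * B ^ i = \sum_(i < r) g i * B ^ i)%N -> f =1 g.
Proof.
elim: r f g => [|r IHr] f g ltf ltg; first by move=> _ [].
have recl (h : 'I_r.+1 -> nat) : (\sum_(i < r.+1) h i * B ^ i =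
    (\sum_(i < r) h (lift ord0 i) * B ^ i) * B + h ord0)%N.
  rewrite big_ord_recl expn0 muln1 addnC big_distrl /=; congr (_ + _)%N.
  by apply: eq_bigr => i _; rewrite -mulnA -expnSr.
have B0 : (0 < B)%N by exact: leq_ltn_trans (ltf ord0).
rewrite !recl => eqfg.
have eq0 : f ord0 = g ord0.
  by have := congr1 (modn^~ B) eqfg; rewrite /= !modnMDl !modn_small.
have eqS : f \o lift ord0 =1 g \o lift ord0.
  apply: IHr => [i|i|]; [exact: ltf|exact: ltg|].
  by move/eqP: eqfg; rewrite eq0 eqn_add2r eqn_pmul2r // => /eqP.
by move=> i; case: (unliftP ord0 i) => [k ->|->]; [exact: eqS|].
Qed.

Context {r d : nat}.
Implicit Types (a : {ffun 'I_r -> 'I_d.+1} -> K) (n : 'I_r -> nat).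

(** Kronecker substitution [n_i = t ^ ((d + 1) ^ i)] turns distinct monomials
    into distinct powers of [t]; an extra factor [t] makes every exponent
    positive. *)
Lemma multivariate_coef_eq0 a :
  (forall n, (forall i, 1 <= n i)%N ->
     \sum_c a c * \prod_(i < r) (n i)%:R ^+ c i = 0) ->
  forall c, a c = 0.
Proof.
move=> F0 c.
pose w (c' : {ffun 'I_r -> 'I_d.+1}) := (\sum_(i < r) c' i * d.+1 ^ i)%N.
pose p : {poly K} := \sum_c' a c' *: 'X^((w c').+1).
have inj_w c' : w c' = w c -> c' = c.
  move/(@digits_inj d.+1 r (fun i => c' i) (fun i => c i)) => eqc.
  by apply/ffunP => i; apply: val_inj; apply: eqc.
have <- : p`_(w c).+1 = a c.
  rewrite coef_sum (bigD1 c) //= coefZ coefXn eqxx mulr1 big1 ?addr0 // => c' neqc.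
  rewrite coefZ coefXn eqSS; case: eqP => [/esym/inj_w eqc|]; last by rewrite mulr0.
  by rewrite eqc eqxx in neqc.
apply: (@bounded_poly_coef_eq0 p 1 0) => // t t1.
suff -> : p.[t%:R] = 0 by rewrite lexx.
transitivity (t%:R * \sum_c' a c' * \prod_(i < r) (t ^ (d.+1 ^ i))%:R ^+ c' i).
  rewrite horner_sum mulr_sumr; apply: eq_bigr => c' _.
  rewrite hornerZ hornerXn exprS mulrCA; congr (_ * (_ * _)).
  rewrite /w expr_sum; apply: eq_bigr => i _.
  by rewrite natrX -exprM mulnC.
by rewrite (F0 (fun i => (t ^ (d.+1 ^ i))%N)) ?mulr0 // => i; rewrite expn_gt0 t1.
Qed.

(** Along each line in the [j]-th direction the polynomial is bounded, hence
    constant; so for [k > 0] the part of degree [k] in [n_j] vanishes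
    identically. *)
Lemma multivariate_bounded_coef_eq0 a (j : 'I_r) :
  (forall n, (forall i, 1 <= n i)%N -> exists C, forall s : nat, (1 <= s)%N ->
     0 <= \sum_c a c * \prod_(i < r) (n i + (i == j) * s)%:R ^+ c i <= C) ->
  forall c : {ffun 'I_r -> 'I_d.+1}, (0 < c j)%N -> a c = 0.
Proof.
move=> bndF c0 c0j; pose a' (c : {ffun 'I_r -> 'I_d.+1}) := if c j == c0 j then a c else 0.
suff /(_ c0) : forall c : {ffun 'I_r -> 'I_d.+1}, a' c = 0 by rewrite /a' eqxx.
apply: multivariate_coef_eq0 => n n1.
pose p : {poly K} :=
  \sum_(c : {ffun 'I_r -> 'I_d.+1}) (a c * \prod_(i < r | i != j) (n i)%:R ^+ c i) *: 'X^(c j).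
have p0 : p`_(c0 j) = 0.
  have [|C bndC] := bndF (fun i => if i == j then 1%N else n i).
    by move=> i; case: eqP.
  apply: (@bounded_poly_coef_eq0 p 2 C) => // s s2.
  have := bndC s.-1; rewrite -ltnS prednK ?(ltnW s2) // => /(_ s2).
  rewrite (_ : \sum_c _ = p.[s%:R]) // horner_sum; apply: eq_bigr => c _.
  rewrite hornerZ hornerXn -mulrA (bigD1 j) //= eqxx mul1n add1n prednK ?(ltnW s2) //.
  congr (_ * _); rewrite mulrC; congr (_ * _).
  apply: eq_bigr => i neq_ij; by rewrite (negbTE neq_ij) mul0n addn0.
transitivity ((n j)%:R ^+ c0 j * p`_(c0 j)); last by rewrite p0 mulr0.
rewrite coef_sum mulr_sumr; apply: eq_bigr => c _; rewrite /a' coefZ coefXn (eq_sym (c0 j : nat)).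
rewrite (val_eqE (c j)); case: eqP => [eqc|_]; last by rewrite mul0r !mulr0.
by rewrite mulr1 (bigD1 j) //= eqc mulrCA.
Qed.

End BoundedPolynomials.

(** * The bound on the mixed polynomial *)

Section Products.
Context {R : comNzRingType}.

Lemma big_ideal_mul_prod (r : nat) (J : 'I_r -> set R) (z : 'I_r -> R) :
  (forall i, J i (z i)) -> (\big[@ideal_mul R/setT]_(i < r) J i) (\prod_(i < r) z i).
Proof.
move=> Jz; apply: (big_rec2 (fun (A : set R) y => A y)) => // i y A _ Ay.
exact: (mem_ideal_smul (V := R^o)).
Qed.

Lemma filtrationM (I : nat -> set R) a b x y : is_filtration I ->
  I a x -> I b y -> I (a + b)%N (x * y).
Proof.
move=> [_ _ _ mulI] Ix Iy; apply: mulI.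
exact: (mem_ideal_smul (V := R^o)).
Qed.

Lemma filtrationX (I : nat -> set R) a x t : is_filtration I ->
  I a x -> I (t * a)%N (x ^+ t).
Proof.
move=> fI Ix; elim: t => [|t IHt]; first by case: fI => _ ->.
by rewrite mulSn exprS; exact: filtrationM.
Qed.

End Products.

Section Limits.
Context {K : realType} {R : comNzRingType} {M : lmodType R} {d : nat}.

Lemma multiplicity0_length (I : nat -> set R) (eps : K) :
  is_multiplicity d M I (0 : K) -> 0 < eps ->
  exists u0, forall u, (u0 <= u)%N ->
    (length_mod K M (I u) <= (eps * u%:R ^+ d)%:E)%E.
Proof.
move=> /fine_cvgP[[u1 _ finu] /(cvgr_lt (0 : K))/(_ eps)] ltu eps0.
have {ltu}[u2 _ ltu] := ltu eps0.
exists (maxn (maxn u1 u2) 1) => u; rewrite !geq_max -andbA => /and3P[le1u le2u u0].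
have ud0 : 0 < u%:R ^+ d :> K by rewrite exprn_gt0 // ltr0n.
have len0 : (0 <= length_mod K M (I u))%E.
  exact/quotient_length_ge0/ideal_smul_submodule.
rewrite EFinM -lee_pdivrMr //; apply: le_trans (_ : eps%:E <= eps%:E)%E => //.
have := ltu u le2u; rewrite /= -lte_fin fineK; last exact: finu.
move/ltW; apply: le_trans; apply: lee_pemull.
  by apply: mule_ge0 => //; rewrite lee_fin invr_ge0 ltW.
by rewrite lee_fin ler1n fact_gt0.
Qed.

End Limits.

Section MixedMultiplicities.
Context {K : realType} {R : comNzRingType} {m : set R} {d r : nat} {M : lmodType R}.
Context {I : 'I_r -> nat -> set R} {e : ('I_r -> nat) -> K}.
Hypotheses (hR : noetherian R) (hm : local_ring m) (hdim : krull_dim_eq R d).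
Hypotheses (fgM : finitely_generated [set: M]).
Hypotheses (hI : forall i : 'I_r, is_primary_filtration m (I i)).
Hypothesis he : is_mixed_multiplicities d M I e.

(** The product of the [I(i)_(t n_i)] contains the [t]-th powers of elements
    [y_k = x_k ^ E], where [x_1, ..., x_d] is a system of parameters and [E] is
    such that [y_k] lies in the product of the [I(i)_(n_i)]. The ideal at
    [n + s e_j] contains the product of [(y_1^t, ..., y_d^t)] with [I(j)_(t s)],
    so its colength on [M] is at most
    [t^d l(M / (y_1, ..., y_d) M) + d l(M / I(j)_(t s) M)]. Here [s] occurs only
    in the last term, which is [o(t^d)] because [e(I(j); M) = 0]. *)
Lemma mixed_polynomial_bounded (j : 'I_r) (n : 'I_r -> nat) :
  is_multiplicity d M (I j) (0 : K) -> (forall i, 1 <= n i)%N ->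
  exists C : K, forall s, (1 <= s)%N ->
    0 <= mixed_polynomial d e (fun i => n i + (i == j) * s)%N <= C.
Proof.
move=> hj n1; have [maxm _] := hm.
have filtI i : is_filtration (I i) by case: (hI i).
have [xs [sizexs xsm radxs]] := system_of_parameters hR hm hdim.
have [c0 lenc0] : exists c0 : K,
    (quotient_length K (ideal_smul [set` xs] [set: M]) <= c0%:E)%E.
  have [|c0] := finite_length_radical (K := K) hR maxm fgM _ radxs.
    exact: generated_submodule.
  by rewrite ideal_smul_generated //; exists c0.
have /choice[a Ia] : forall i, exists a, forall x, x \in xs -> I i (n i) (x ^+ a).
  move=> i; have [_ /(_ _ (n1 i))[[idI _ _] radI]] := hI i.
  by apply: seq_exp_radical => // x /xsm; rewrite radI.
pose E := (\sum_(i < r) a i)%N.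
exists (c0 * E%:R ^+ d + d%:R) => s s1.
pose n' i := (n i + (i == j) * s)%N.
pose J t := \big[@ideal_mul R/setT]_(i < r) I i (t * n' i)%N.
have cvgP : (fun t => length_mod K M (J t) * ((t%:R ^+ d)^-1)%:E)%E @ \oo
    --> (mixed_polynomial d e n')%:E.
  by apply: he => i; exact: leq_trans (n1 i) (leq_addr _ _).
have len0 t : (0 <= length_mod K M (J t))%E.
  exact/quotient_length_ge0/ideal_smul_submodule.
apply/andP; split; rewrite -lee_fin.
  apply: cvge_ge cvgP; exists 0%N => // t _.
  by apply: mule_ge0 => //; rewrite lee_fin invr_ge0 exprn_ge0.
(* This choice makes the length of [M / I(j)_(t s) M] at most [t^d]. *)
have [|u0 lenI] := multiplicity0_length (eps := (s%:R ^+ d)^-1) hj.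
  by rewrite invr_gt0 exprn_gt0 // ltr0n.
apply: cvge_le cvgP; exists (maxn u0 1) => // t /=; rewrite geq_max => /andP[u0t t1].
rewrite lee_pdivrMr ?exprn_gt0 ?ltr0n //.
pose L := ideal_smul (I j (t * s)%N) [set: M].
have lenL : (quotient_length K L <= (t%:R ^+ d)%:E)%E.
  have /lenI : (u0 <= t * s)%N by apply: leq_trans u0t _; rewrite leq_pmulr.
  rewrite natrM exprMn mulrCA mulVf ?mulr1 //.
  by rewrite expf_neq0 // pnatr_eq0 -lt0n.
pose ys := [seq x ^+ (E * t) | x <- xs].
have lenys : (quotient_length K (ideal_smul [set` ys] [set: M])
               <= (c0 *+ (E * t) ^ d)%:E)%E.
  by rewrite -sizexs; exact: quotient_length_exp.
apply: le_trans (_ : (c0 *+ (E * t) ^ d + t%:R ^+ d *+ size ys)%:E <= _)%E; last first.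
  rewrite size_map sizexs -EFinM lee_fin mulrDl expnMn -[c0 *+ _]mulr_natr natrM.
  by rewrite !natrX mulrA -[t%:R ^+ d *+ d]mulr_natl.
apply: le_trans (quotient_length_ideal_smul_seq lenys lenL).
apply: quotient_lengthS; apply: ideal_smul_sub => [|y u /mapP[x xs_x ->]].
  exact: ideal_smul_submodule.
pose W := [set u : M | ideal_smul (J t) setT (x ^+ (E * t) *: u)].
suff : L `<=` W by apply.
have [N0 NZD] := ideal_smul_submodule (J t) [set: M].
apply: ideal_smul_sub => [|b v Ib _].
  by split=> [|b v w Wv Ww]; rewrite /W /= ?scaler0 // linear_scale; exact: NZD.
rewrite /W /= scalerA; apply: mem_ideal_smul => //.
have -> : x ^+ (E * t) * b = \prod_(i < r) (x ^+ a i ^+ t * (if i == j then b else 1)).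
  rewrite big_split /= -big_mkcond big_pred1_eq; congr (_ * _).
  by rewrite /E big_distrl expr_sum; apply: eq_bigr => i _; rewrite exprM.
apply: big_ideal_mul_prod => i; rewrite mulnDr; apply: filtrationM => //.
  by apply: filtrationX => //; exact: Ia.
case: eqP => [->|_]; first by rewrite mul1n.
by rewrite mul0n muln0; case: (filtI i) => _ ->.
Qed.

End MixedMultiplicities.

Unset Implicit Arguments.

Theorem corollary2 (K : realType) (R : comNzRingType) (m : idealr R) (d r : nat)
    (M : lmodType R) (I : 'I_r -> nat -> set R) (e : ('I_r -> nat) -> K)
    (hnoeth : noetherian R)
    (hlocal : local_ring [set` m])
    (hdim : krull_dim_eq R d)
    (hd : (1 <= d)%N)
    (hr : (1 <= r)%N)
    (hN : module_dim_lt (nilradical (completion m) : set (completion m)^o) d)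
    (hM : finitely_generated [set: M])
    (hI : forall i : 'I_r, is_primary_filtration [set` m] (I i))
    (he : is_mixed_multiplicities d M I e)
    (j : 'I_r)
    (hj : is_multiplicity d M (I j) (0 : K))
    (c : 'I_r -> nat)
    (hc : (\sum_(i < r) c i)%N = d)
    (hcj : (0 < c j)%N) :
  e c = 0.
Proof.
pose a (c' : {ffun 'I_r -> 'I_d.+1}) : K :=
  if (\sum_(i < r) c' i == d)%N then
    (\prod_(i < r) (c' i)`!%:R)^-1 * e (fun i => c' i) else 0.
have mixedE n : mixed_polynomial d e n = \sum_c' a c' * \prod_(i < r) (n i)%:R ^+ c' i.
  rewrite /mixed_polynomial big_mkcond; apply: eq_bigr => c' _.
  by rewrite /a; case: ifP; rewrite ?mul0r.
have lec i : (c i < d.+1)%N by rewrite ltnS -hc (bigD1 i) //= leq_addr.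
pose c' : {ffun 'I_r -> 'I_d.+1} := [ffun i => Ordinal (lec i)].
have c'E : (fun i => c' i : nat) = c by apply: funext => i; rewrite ffunE.
have /eqP : a c' = 0.
  apply: (@multivariate_bounded_coef_eq0 _ _ _ a j); last by rewrite ffunE.
  move=> n n1.
  have [C bndC] := mixed_polynomial_bounded hnoeth hlocal hdim hM hI he hj n1.
  by exists C => s /bndC; rewrite mixedE.
rewrite /a c'E (eq_bigr c) => [|i _]; last by rewrite ffunE.
rewrite hc eqxx mulf_eq0 invr_eq0 => /orP[/prodf_eq0[i _]|/eqP //].
by rewrite pnatr_eq0 gtn_eqF ?fact_gt0.
Qed.
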